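(* Let $p>1$, let $c<1$, and let $f(z)=\sum_{n=0}^{\infty}a_n z^n$ be an entire function of $p$-exponential growth of order $c\ln p$. Then there exists an entire function $g(z)$ such that $$g(z\dotplus 1)-g(z)=f(z),$$ where $g(z\dotplus 1)=T_p^1 g(z)$ and $T_p^1$ is the operator defined with $\delta_k=\frac{(-1;p)_k}{2^k}$, $k=0,1,2,\dots$.
   Context: Notation for $p>0$, $p\ne1$: $[n]_p=\frac{1-p^n}{1-p}$, $[n]_p!=\prod_{j=1}^n[j]_p$, ${n\brack k}_p=\frac{[n]_p!}{[k]_p![n-k]_p!}$, and $(a;p)_k=\prod_{j=0}^{k-1}(1-ap^j)$. Given a sequence $(\delta_k)_{k\ge0}$, the operator $T_p^1$ acts on monomials by $$T_p^1x^n:=T_n(x):=\sum_{k=0}^n{n\brack k}_p x^{n-k}\delta_k,$$ and on power series $h(x)=\sum_{n\ge0}a_nx^n$ linearly (termwise): $h(x\dotplus1):=T_p^1h(x)=\sum_{n=0}^\infty a_nT_n(x)$. An entire function $f$ has $p$-exponential growth of order $k$ (and finite type) if there are real numbers $K>0$ and $\alpha$ such that $|f(x)|<K|x|^\alpha\exp\left(\frac{k\ln^2|x|}{2\ln^2p}\right)$ for $x\ne0$. *)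

(* Defs.v *)
From Stdlib Require Export Reals.
From Coquelicot Require Export Coquelicot.

Open Scope R_scope.

(* [n]_p, used only for p > 0, p <> 1. *)
Definition qnum (p : R) (n : nat) : R := (1 - p ^ n) / (1 - p).

Fixpoint qfact (p : R) (n : nat) : R :=
  match n with
  | O => 1
  | S m => qfact p m * qnum p (S m)
  end.

(* Meaningful for k <= n only, because of the truncated subtraction. *)
Definition qbinom (p : R) (n k : nat) : R :=
  qfact p n / (qfact p k * qfact p (n - k)).

(* (a;p)_k, the product of 1 - a p^j over 0 <= j < k. *)
Fixpoint qpoch (a p : R) (k : nat) : R :=
  match k with
  | O => 1
  | S j => qpoch a p j * (1 - a * p ^ j)
  end.

(* T_n(x) = T_p^1 x^n; [sum_n u n] has the n + 1 terms u 0, ..., u n. *)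
Definition Tmono (p : R) (delta : nat -> C) (n : nat) (x : C) : C :=
  sum_n (fun k => (RtoC (qbinom p n k) * Cpow x (n - k) * delta k)%C) n.

(* [is_Tshift p delta a x l]: for h(x) = sum_n a_n x^n, the series
   sum_n a_n T_n(x) defining h(x [+] 1) = T_p^1 h (x) converges, with sum l. *)
Definition is_Tshift (p : R) (delta : nat -> C) (a : nat -> C) (x l : C) : Prop :=
  is_series (fun n => (a n * Tmono p delta n x)%C) l.

(* [ex_derive] is complex differentiability here: f is a map C -> C and the
   scalar ring is C_AbsRing. *)
Definition entire (f : C -> C) : Prop := forall z : C, ex_derive f z.

(* p-exponential growth of order k and finite type. *)
Definition p_exp_growth (p k : R) (f : C -> C) : Prop :=
  exists K alpha : R, 0 < K /\
    forall x : C, x <> RtoC 0 ->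
      Cmod (f x) <
        K * Rpower (Cmod x) alpha
          * exp (k * (ln (Cmod x)) ^ 2 / (2 * (ln p) ^ 2)).

(* Main.v *)
Require Import Defs.
From Stdlib Require Import Reals Arith Lra Lia IndefiniteDescription.
From Coquelicot Require Import Coquelicot.

(* Put A_n = [n]_p! a_n, B_n = [n]_p! b_n and d_k = delta_k / [k]_p!.  Comparing
   coefficients of x^m, the equation g(x [+] 1) - g(x) = f(x) reads
   sum_(k >= 1) d_k B_(m+k) = A_m for all m >= 0, that is (E(S) - 1) B = A where
   S is the left shift and E(t) = sum_k d_k t^k.  Since 0 <= d_k <= 1 and
   d_1 = 1, the series t / (E(t) - 1) = sum_j e_j t^j satisfies |e_j| <= 2^j.
   Cauchy's estimate on |z| = p^n gives
   |A_n| <= K exp(beta n - (1 - c) n^2 ln p / 2), so A decreases faster than any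
   geometric sequence, and B_0 = 0, B_(m+1) = sum_j e_j A_(m+j) is a solution
   decreasing as fast.  All rearrangements are then absolutely convergent. *)

(** * Complex series *)

(* [ring] looks up the ring structure from the type of the left-hand side,
   which for [sum_n] is the carrier of [C_AbelianMonoid] rather than [C]. *)
Ltac Cring :=
  match goal with |- @eq _ ?x ?y => change (@eq C x y); apply Ceq_minus; ring end.

Lemma Csum_S (u : nat -> C) n : (sum_n u (S n) = sum_n u n + u (S n) :> C)%C.
Proof. exact (sum_Sn u n). Qed.

Lemma Csum_split_first (u : nat -> C) n :
  (sum_n u (S n) = u O + sum_n (fun k => u (S k)) n :> C)%C.
Proof.
  induction n as [|n IH].
  - rewrite Csum_S, !sum_O; reflexivity.
  - rewrite Csum_S, IH, Csum_S; ring.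
Qed.

Lemma Csum_rev (u : nat -> C) n :
  sum_n u n = sum_n (fun k => u (n - k)%nat) n :> C.
Proof.
  revert u; induction n as [|n IH]; intros u.
  - now rewrite !sum_O.
  - rewrite Csum_split_first, (IH (fun k => u (S k))), Csum_S, Nat.sub_diag.
    rewrite Cplus_comm; f_equal; apply sum_n_ext_loc; intros k Hk.
    f_equal; lia.
Qed.

Lemma Csum_mult_l (x : C) (u : nat -> C) n :
  sum_n (fun k => x * u k)%C n = (x * sum_n u n)%C :> C.
Proof. exact (sum_n_mult_l x u n). Qed.

Lemma Csum_plus (u v : nat -> C) n :
  sum_n (fun k => u k + v k)%C n = (sum_n u n + sum_n v n)%C :> C.
Proof. exact (sum_n_plus u v n). Qed.

Lemma Cmod_Csum (u : nat -> C) (v : nat -> R) n :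
  (forall k, (k <= n)%nat -> Cmod (u k) <= v k) -> Cmod (sum_n u n) <= sum_n v n.
Proof.
  induction n as [|n IH]; intros H.
  - rewrite !sum_O; apply H; lia.
  - rewrite Csum_S, sum_Sn.
    eapply Rle_trans; [apply Cmod_triangle|].
    apply Rplus_le_compat; [apply IH; intros; apply H; lia | apply H; lia].
Qed.

Lemma is_series_Cmod (u : nat -> C) (l : C) :
  is_series u l <-> is_lim_seq (fun n => Cmod (sum_n u n - l)) 0.
Proof.
  split; intros H.
  - apply is_lim_seq_spec; intros eps.
    (* Balls of [C] are squares: radius e only bounds the modulus by sqrt 2 times e, whence
       [eps / 2] and the inequality sqrt 2 < 2. *)
    assert (He : 0 < eps / 2) by (destruct eps; simpl; lra).
    assert (H1 := proj1 (filterlim_locally _ _) H (mkposreal _ He)).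
    destruct H1 as [N HN]; exists N; intros n Hn.
    apply HN, C_NormedModule_mixin_compat2 in Hn; simpl in Hn.
    change (minus (sum_n u n) l) with (sum_n u n - l)%C in Hn.
    rewrite Rminus_0_r, Rabs_pos_eq by apply Cmod_ge_0.
    assert (sqrt 2 < 2) by (apply Rlt_le_trans with (sqrt 4);
      [apply sqrt_lt_1; lra | replace 4 with (2 * 2) by ring; rewrite sqrt_square; lra]).
    destruct eps as [e e0]; simpl in *; nra.
  - apply is_lim_seq_spec in H.
    apply filterlim_locally; intros eps.
    destruct (H eps) as [N HN]; exists N; intros n Hn.
    apply C_NormedModule_mixin_compat1.
    specialize (HN n Hn); rewrite Rminus_0_r, Rabs_pos_eq in HN by apply Cmod_ge_0.
    exact HN.
Qed.

Lemma is_series_Cmult_l (x : C) (u : nat -> C) (l : C) :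
  is_series u l -> is_series (fun n => x * u n)%C (x * l)%C.
Proof. exact (is_series_scal_l x u l). Qed.

Lemma is_series_Cplus (u v : nat -> C) (k l : C) :
  is_series u k -> is_series v l -> is_series (fun n => u n + v n)%C (k + l)%C.
Proof. exact (is_series_plus u v k l). Qed.

Lemma ex_series_Cgeom (u : nat -> C) (M q : R) :
  0 <= q < 1 -> (forall n, Cmod (u n) <= M * q ^ n) -> ex_series u.
Proof.
  intros Hq H.
  apply (ex_series_le (V := C_CompleteNormedModule)) with (fun n => M * q ^ n).
  - exact H.
  - apply (ex_series_scal_l (K := R_AbsRing) M (fun n => q ^ n)).
    exists (/ (1 - q)); apply is_series_geom; rewrite Rabs_pos_eq; lra.
Qed.

(** For q <= 1/2 one has q^(n+1) <= q^n - q^(n+1), so the terms beyond N are dominated by a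
    telescoping sum of total at most M q^N. *)
Lemma series_tail_geom (u : nat -> C) (l : C) (M q : R) (N : nat) :
  0 <= q <= 1 / 2 -> (forall n, Cmod (u n) <= M * q ^ n) -> is_series u l ->
  Cmod (sum_n u N - l) <= M * q ^ N.
Proof.
  intros Hq Hu Hl.
  assert (HM : 0 <= M) by
    (specialize (Hu O); simpl in Hu; generalize (Cmod_ge_0 (u O)); lra).
  assert (Hd : forall k, Cmod (sum_n u N - sum_n u (N + k)) <= M * (q ^ N - q ^ (N + k))).
  { induction k as [|k IH].
    - rewrite Nat.add_0_r; replace (sum_n u N - sum_n u N)%C with (RtoC 0) by ring.
      rewrite Cmod_0; lra.
    - rewrite Nat.add_succ_r, Csum_S.
      replace (sum_n u N - (sum_n u (N + k)%nat + u (S (N + k))))%C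
        with ((sum_n u N - sum_n u (N + k)%nat) + - u (S (N + k)))%C by ring.
      eapply Rle_trans; [apply Cmod_triangle|].
      rewrite Cmod_opp; specialize (Hu (S (N + k))); simpl in *.
      assert (0 <= q ^ (N + k)) by (apply pow_le; lra).
      assert (0 <= M * q ^ (N + k) * (1 - 2 * q)) by
        (apply Rmult_le_pos; [apply Rmult_le_pos|]; lra).
      nra. }
  apply is_series_Cmod in Hl.
  apply (is_lim_seq_incr_n _ N) in Hl.
  assert (L : is_lim_seq (fun k => M * q ^ N + Cmod (sum_n u (k + N)%nat - l)) (M * q ^ N + 0))
    by (apply is_lim_seq_plus'; [apply is_lim_seq_const | exact Hl]).
  rewrite Rplus_0_r in L.
  apply (is_lim_seq_le (fun _ => Cmod (sum_n u N - l)) _ (Cmod (sum_n u N - l)) (M * q ^ N))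
    in L; [exact L | | apply is_lim_seq_const].
  intros k.
  replace (sum_n u N - l)%C with ((sum_n u N - sum_n u (k + N)%nat)
    + (sum_n u (k + N)%nat - l))%C by ring.
  eapply Rle_trans; [apply Cmod_triangle|].
  apply Rplus_le_compat_r.
  specialize (Hd k); rewrite Nat.add_comm.
  assert (0 <= q ^ (N + k)) by (apply pow_le; lra).
  nra.
Qed.

Lemma Cmod_series_le_geom (u : nat -> C) (l : C) (M q : R) :
  0 <= q <= 1 / 2 -> (forall n, Cmod (u n) <= M * q ^ n) -> is_series u l ->
  Cmod l <= 2 * M.
Proof.
  intros Hq Hu Hl.
  assert (H := series_tail_geom u l M q O Hq Hu Hl).
  specialize (Hu O); rewrite sum_O in H; simpl in *.
  replace l with (u O + - (u O - l))%C by ring.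
  eapply Rle_trans; [apply Cmod_triangle|].
  rewrite Cmod_opp; lra.
Qed.

Lemma INR_lt_pow2 n : INR n < 2 ^ n.
Proof.
  induction n as [|n IH]; [simpl; lra|].
  rewrite S_INR; simpl.
  assert (1 <= 2 ^ n) by (apply pow_R1_Rle; lra). lra.
Qed.

Lemma Csum_triangle (u : nat -> nat -> C) N :
  sum_n (fun n => sum_n (fun i => u i (n - i)%nat) n) N
  = sum_n (fun i => sum_n (u i) (N - i)) N :> C.
Proof.
  induction N as [|N IH].
  - now rewrite !sum_O.
  - rewrite Csum_S, IH, !Csum_S, Nat.sub_diag, sum_O, Cplus_assoc, <- Csum_plus.
    f_equal; apply sum_n_ext_loc; intros i Hi.
    replace (S N - i)%nat with (S (N - i)) by lia.
    now rewrite Csum_S.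
Qed.

(* The triangle [i + j <= N] is covered by the rows [i <= N] up to tails of
   total size [O((N + 1) 4^(-N))], so both summations have the same limit. *)
Lemma series_rows_diagonals (u : nat -> nat -> C) (r : nat -> C) (M : R) (l : C) :
  (forall i j, Cmod (u i j) <= M * (1 / 4) ^ (i + j)) ->
  (forall i, is_series (u i) (r i)) ->
  is_series r l <-> is_series (fun n => sum_n (fun i => u i (n - i)%nat) n) l.
Proof.
  intros Hu Hr.
  assert (Hclose : forall N,
    Cmod (sum_n r N - sum_n (fun n => sum_n (fun i => u i (n - i)%nat) n) N)
    <= M * 2 * (1 / 2) ^ N).
  { intros N.
    rewrite Csum_triangle.
    replace (sum_n r N - sum_n (fun i => sum_n (u i) (N - i)) N)%C
      with (sum_n (fun i => r i + -(1) * sum_n (u i) (N - i))%C N)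
      by (rewrite Csum_plus, Csum_mult_l; Cring).
    eapply Rle_trans.
    - apply (Cmod_Csum _ (fun _ => M * (1 / 4) ^ N)).
      intros i Hi.
      replace (r i + -(1) * sum_n (u i) (N - i))%C
        with (- (sum_n (u i) (N - i) - r i))%C by ring.
      rewrite Cmod_opp.
      eapply Rle_trans.
      + apply (series_tail_geom (u i) (r i) (M * (1 / 4) ^ i) (1 / 4)); [lra | | apply Hr].
        intros n; rewrite Rmult_assoc, <- pow_add; apply Hu.
      + rewrite Rmult_assoc, <- pow_add.
        replace (i + (N - i))%nat with N by lia; lra.
    - rewrite sum_n_const.
      assert (HM : 0 <= M).
      { specialize (Hu O O); simpl in Hu; generalize (Cmod_ge_0 (u O O)); lra. }
      replace ((1 / 4) ^ N) with ((1 / 2) ^ N * (1 / 2) ^ N)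
        by (rewrite <- Rpow_mult_distr; f_equal; lra).
      (* The N + 1 rows contribute M 4^(-N) each; N + 1 < 2^(N+1) bounds the total by 2 M 2^(-N). *)
      assert (H2 := INR_lt_pow2 (S N)); simpl pow in H2.
      assert (Hp : 2 ^ N * (1 / 2) ^ N = 1)
        by (rewrite <- Rpow_mult_distr; replace (2 * (1 / 2)) with 1 by lra; apply pow1).
      assert (0 < (1 / 2) ^ N) by (apply pow_lt; lra).
      replace (M * 2 * (1 / 2) ^ N) with (2 * (2 ^ N * (1 / 2) ^ N) * (M * (1 / 2) ^ N))
        by (rewrite Hp; ring).
      replace (INR (S N) * (M * ((1 / 2) ^ N * (1 / 2) ^ N)))
        with (INR (S N) * (1 / 2) ^ N * (M * (1 / 2) ^ N)) by ring.
      apply Rmult_le_compat_r; [apply Rmult_le_pos; lra|].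
      replace (2 * (2 ^ N * (1 / 2) ^ N)) with (2 * 2 ^ N * (1 / 2) ^ N) by ring.
      apply Rmult_le_compat_r; lra. }
  assert (Hz : is_lim_seq (fun N => M * 2 * (1 / 2) ^ N) 0).
  { replace (Finite 0) with (Rbar_mult (M * 2) 0) by (simpl; f_equal; ring).
    apply is_lim_seq_scal_l, is_lim_seq_geom; rewrite Rabs_pos_eq; lra. }
  assert (Htrans : forall v w : nat -> C,
    (forall N, Cmod (sum_n v N - sum_n w N) <= M * 2 * (1 / 2) ^ N) ->
    is_series v l -> is_series w l).
  { intros v w Hvw Hv; apply is_series_Cmod in Hv; apply is_series_Cmod.
    apply is_lim_seq_le_le with (u := fun _ => 0)
      (w := fun N => M * 2 * (1 / 2) ^ N + Cmod (sum_n v N - l)).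
    - intros N; split; [apply Cmod_ge_0|].
      replace (sum_n w N - l)%C with (- (sum_n v N - sum_n w N) + (sum_n v N - l))%C by ring.
      eapply Rle_trans; [apply Cmod_triangle|].
      rewrite Cmod_opp; apply Rplus_le_compat_r, Hvw.
    - apply is_lim_seq_const.
    - replace (Finite 0) with (Finite (0 + 0)) by (f_equal; ring).
      now apply is_lim_seq_plus'. }
  split; apply Htrans; [exact Hclose|].
  intros N; rewrite <- Cmod_opp.
  replace (- (sum_n (fun n => sum_n (fun i => u i (n - i)%nat) n) N - sum_n r N))%C
    with (sum_n r N - sum_n (fun n => sum_n (fun i => u i (n - i)%nat) n) N)%C by ring.
  apply Hclose.
Qed.

Lemma is_pseries_C (a : nat -> C) (z l : C) :
  is_pseries a z l <-> is_series (fun n => a n * z ^ n)%C l.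
Proof.
  assert (E : forall n, scal (pow_n z n) (a n) = (a n * z ^ n)%C :> C).
  { intros n; change (scal (pow_n z n) (a n)) with (pow_n z n * a n)%C.
    rewrite Cmult_comm; f_equal; easy. }
  split; apply is_series_ext; intros n; [apply E | symmetry; apply E].
Qed.

(** Beyond the first, each term is a difference of two consecutive errors [sum_n u n - l], which are
    bounded because they tend to 0. *)
Lemma is_series_terms_bounded (u : nat -> C) (l : C) :
  is_series u l -> exists M, forall n, Cmod (u n) <= M.
Proof.
  intros H; apply is_series_Cmod in H.
  destruct (filterlim_bounded _ (ex_intro _ 0 H)) as [M HM].
  exists (2 * M + Cmod (u O)); intros n.
  assert (H' : forall n, Cmod (sum_n u n - l) <= M).
  { intros k; eapply Rle_trans; [apply Rle_abs | apply (HM k)]. }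
  assert (0 <= M) by (eapply Rle_trans; [apply Cmod_ge_0 | apply (H' O)]).
  destruct n as [|n]; [lra|].
  replace (u (S n)) with ((sum_n u (S n) - l) + - (sum_n u n - l))%C
    by (rewrite Csum_S; Cring).
  eapply Rle_trans; [apply Cmod_triangle|]; rewrite Cmod_opp.
  generalize (H' n), (H' (S n)), (Cmod_ge_0 (u O)); lra.
Qed.

(** * Cauchy's estimate *)

Definition cis (t : R) : C := (cos t, sin t).

Lemma cis_pow t n : (cis t ^ n)%C = cis (INR n * t).
Proof.
  induction n as [|n IH].
  - unfold cis; simpl; rewrite Rmult_0_l, cos_0, sin_0; reflexivity.
  - rewrite Cpow_S, IH, S_INR, Rmult_plus_distr_r, Rmult_1_l.
    unfold cis, Cmult; simpl; rewrite cos_plus, sin_plus; f_equal; ring.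
Qed.

Lemma Cmod_cis t : Cmod (cis t) = 1.
Proof.
  unfold Cmod, cis; simpl fst; simpl snd.
  replace (cos t ^ 2 + sin t ^ 2) with 1; [apply sqrt_1|].
  generalize (sin2_cos2 t); unfold Rsqr; lra.
Qed.

(** Multiplying the sum by w - 1 telescopes it to w^(n+1) - 1 = 0, and w - 1 is invertible. *)
Lemma Csum_geom_root (w : C) n :
  w <> RtoC 1 -> (w ^ S n)%C = RtoC 1 -> sum_n (fun j => w ^ j)%C n = RtoC 0.
Proof.
  intros Hw H.
  assert (G : ((w - 1) * sum_n (fun j => w ^ j)%C n = w ^ S n - 1)%C).
  { clear H; induction n as [|n IH].
    - rewrite sum_O; simpl; Cring.
    - rewrite Csum_S, Cmult_plus_distr_l, IH, !Cpow_S; Cring. }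
  rewrite H in G; replace (RtoC 1 - RtoC 1)%C with (RtoC 0) in G by ring.
  assert (Hz : (w - 1)%C <> RtoC 0) by (apply Cminus_eq_contra; exact Hw).
  transitivity (/ (w - 1) * ((w - 1) * sum_n (fun j => w ^ j)%C n))%C.
  - rewrite Cmult_assoc, Cinv_l by exact Hz; Cring.
  - rewrite G; Cring.
Qed.

(* Discrete Cauchy formula: averaging [P(r w^j) w^(-jn)] over the powers of
   [w = exp(i pi / (N + 1))] isolates the coefficient of degree [n <= N]. *)
Lemma poly_coeff_bound (a : nat -> C) (r M : R) (N n : nat) :
  0 <= r -> (n <= N)%nat ->
  (forall z, Cmod z = r -> Cmod (sum_n (fun k => a k * z ^ k)%C N) <= M) ->
  Cmod (a n) * r ^ n <= M.
Proof.
  intros Hr Hn HM.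
  (* The root of unity has order 2m rather than m: for 0 < d < m the angle d pi / m of [w ^ d] then
     lies in (0, pi), where the sine is positive, so [w ^ d] is not 1. Differences of exponents up
     to N stay below m. *)
  set (m := S N); set (t := PI / INR m); set (w := cis t).
  assert (Hm : 0 < INR m) by (apply lt_0_INR; unfold m; lia).
  assert (Hw1 : (w ^ (2 * m))%C = RtoC 1).
  { unfold w; rewrite cis_pow, mult_INR; unfold t.
    replace (INR 2 * INR m * (PI / INR m)) with (2 * PI) by (change (INR 2) with (1 + 1); field; lra).
    unfold cis; rewrite cos_2PI, sin_2PI; reflexivity. }
  assert (Hwd : forall d, (0 < d < m)%nat -> (w ^ d)%C <> RtoC 1).
  { intros d Hd E; unfold w in E; rewrite cis_pow in E.
    apply (f_equal snd) in E; simpl in E.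
    assert (Hp := PI_RGT_0).
    assert (0 < sin (INR d * t)); [|lra].
    assert (H1 : 0 < INR d) by (apply lt_0_INR; lia).
    assert (H2 : INR d < INR m) by (apply lt_INR; lia).
    unfold t; replace (INR d * (PI / INR m)) with (PI * (INR d / INR m)) by (field; lra).
    assert (0 < INR d / INR m < 1).
    { split; [apply Rdiv_lt_0_compat; lra|].
      apply Rmult_lt_reg_r with (INR m); [lra|].
      unfold Rdiv; rewrite Rmult_assoc, Rinv_l by lra; lra. }
    apply sin_gt_0; nra. }
  (* [e k] represents k - n modulo 2m by a natural number; the subtraction is exact since n <= N <
     2m. *)
  set (e := fun k => (k + (2 * m - n))%nat).
  assert (Hwk : forall k, (k <= N)%nat -> k <> n -> (w ^ e k)%C <> RtoC 1).
  { intros k Hk Hkn E.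
    assert (E1 : (w ^ n * w ^ e k = w ^ k)%C).
    { rewrite <- Cpow_add_r; unfold e.
      replace (n + (k + (2 * m - n)))%nat with (k + 2 * m)%nat by (unfold m; lia).
      rewrite Cpow_add_r, Hw1; ring. }
    rewrite E in E1.
    assert (Hnz : forall i, (w ^ i)%C <> RtoC 0).
    { intros i H0; apply (f_equal Cmod) in H0.
      unfold w in H0; rewrite Cmod_pow, Cmod_cis, pow1, Cmod_0 in H0; lra. }
    destruct (Nat.lt_ge_cases k n) as [Hlt|Hge].
    - apply (Hwd (n - k)%nat); [unfold m; lia|].
      replace n with (k + (n - k))%nat in E1 at 1 by lia.
      rewrite Cpow_add_r in E1.
      replace (w ^ (n - k))%C with (/ w ^ k * (w ^ k * w ^ (n - k) * 1))%C
        by (field; apply Hnz).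
      rewrite E1; field; apply Hnz.
    - apply (Hwd (k - n)%nat); [unfold m; lia|].
      replace k with (n + (k - n))%nat in E1 by lia.
      rewrite Cpow_add_r in E1.
      replace (w ^ (k - n))%C with (/ w ^ n * (w ^ n * w ^ (k - n)))%C
        by (field; apply Hnz).
      rewrite <- E1; field; apply Hnz. }
  (* The indices 0, ..., L make up one full period of 2m powers of [w]. *)
  set (L := (2 * N + 1)%nat).
  assert (HL : S L = (2 * m)%nat) by (unfold L, m; lia).
  assert (Hcol : forall k, (k <= N)%nat ->
    sum_n (fun j => (w ^ e k) ^ j)%C L = if Nat.eq_dec k n then RtoC (INR (2 * m)) else RtoC 0).
  { intros k Hk; destruct (Nat.eq_dec k n) as [->|Hkn].
    - unfold e; replace (n + (2 * m - n))%nat with (2 * m)%nat by (unfold m; lia).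
      rewrite Hw1, <- HL.
      clear; induction L as [|L IH].
      + rewrite sum_O; simpl; reflexivity.
      + rewrite Csum_S, IH, Cpow_1_l, (S_INR (S L)), RtoC_plus; reflexivity.
    - apply Csum_geom_root; [now apply Hwk|].
      rewrite HL, <- Cpow_mult_r, Nat.mul_comm, Cpow_mult_r, Hw1, Cpow_1_l; reflexivity. }
  set (P := fun z : C => sum_n (fun k => a k * z ^ k)%C N : C).
  assert (Hsum : sum_n (fun j => P (r * w ^ j) * (w ^ (2 * m - n)) ^ j)%C L
    = (INR (2 * m) * (a n * r ^ n))%C :> C).
  { transitivity (sum_n (fun j => sum_n (fun k => (a k * r ^ k) * (w ^ e k) ^ j)%C N) L : C).
    { apply sum_n_ext; intros j; unfold P.
      rewrite Cmult_comm, <- Csum_mult_l; apply sum_n_ext; intros k.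
      unfold e; rewrite Cpow_add_r, !Cpow_mult_l, <- !Cpow_mult_r.
      rewrite (Nat.mul_comm j k); Cring. }
    (* After the exchange, the inner sums over j vanish by [Hcol] except for k = n. *)
    rewrite sum_n_switch.
    transitivity (sum_n (fun k => if Nat.eq_dec k n
      then (INR (2 * m) * (a n * r ^ n))%C else RtoC 0) N : C).
    { apply sum_n_ext_loc; intros k Hk.
      rewrite Csum_mult_l, Hcol by exact Hk.
      destruct (Nat.eq_dec k n) as [->|]; Cring. }
    clear -Hn.
    generalize (INR (2 * m) * (a n * r ^ n))%C; intros x.
    assert (H0 : forall N', (N' < n)%nat ->
      sum_n (fun k => if Nat.eq_dec k n then x else RtoC 0) N' = RtoC 0).
    { induction N' as [|N' IH]; intros H.
      - rewrite sum_O; destruct (Nat.eq_dec 0 n); [lia|reflexivity].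
      - rewrite Csum_S, IH by lia; destruct (Nat.eq_dec (S N') n); [lia|]. Cring. }
    induction N as [|N IH].
    - rewrite sum_O; destruct (Nat.eq_dec 0 n); [reflexivity|lia].
    - rewrite Csum_S; destruct (Nat.eq_dec (S N) n) as [E|E].
      + rewrite H0 by lia; Cring.
      + rewrite IH by lia; Cring. }
  assert (Hb : Cmod (sum_n (fun j => P (r * w ^ j) * (w ^ (2 * m - n)) ^ j)%C L)
    <= INR (2 * m) * M).
  { rewrite <- HL, <- sum_n_const; apply Cmod_Csum; intros j _.
    assert (H1 : forall i, Cmod (w ^ i) = 1)
      by (intros i; unfold w; rewrite Cmod_pow, Cmod_cis, pow1; reflexivity).
    rewrite Cmod_mult, Cmod_pow, H1, pow1, Rmult_1_r; apply HM.
    rewrite Cmod_mult, H1, Cmod_R, Rabs_pos_eq; lra. }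
  rewrite Hsum, !Cmod_mult, Cmod_R, Cmod_pow, Cmod_R, (Rabs_pos_eq r Hr),
    Rabs_pos_eq in Hb by apply pos_INR.
  apply Rmult_le_reg_l in Hb; [exact Hb|].
  apply lt_0_INR; unfold m; lia.
Qed.

(** Convergence at 2r gives |a_k| r^k <= K 2^(-k), so on the circle of radius r the partial sums are
    within K 2^(-N) of f. The polynomial bound applies to them, and N tends to infinity. *)
Lemma cauchy_estimate (a : nat -> C) (f : C -> C) (r M : R) (n : nat) :
  0 <= r -> (forall z, is_pseries a z (f z)) ->
  (forall z, Cmod z = r -> Cmod (f z) <= M) -> Cmod (a n) * r ^ n <= M.
Proof.
  intros Hr Ha HM.
  destruct (is_series_terms_bounded _ _ (proj1 (is_pseries_C _ _ _) (Ha (RtoC (2 * r)))))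
    as [K HK].
  assert (Hbd : forall N, (n <= N)%nat -> Cmod (a n) * r ^ n <= M + K * (1 / 2) ^ N).
  { intros N HN; apply (poly_coeff_bound a r _ N n Hr HN).
    intros z Hz.
    assert (Hser := proj1 (is_pseries_C _ _ _) (Ha z)).
    assert (T : Cmod (sum_n (fun k => a k * z ^ k)%C N - f z) <= K * (1 / 2) ^ N).
    { apply series_tail_geom; [lra | | exact Hser].
      intros k; specialize (HK k).
      rewrite Cmod_mult, Cmod_pow, Cmod_R, Rabs_pos_eq in HK by lra.
      rewrite Cmod_mult, Cmod_pow, Hz.
      replace (Cmod (a k) * r ^ k) with (Cmod (a k) * (2 * r) ^ k * (1 / 2) ^ k).
      - apply Rmult_le_compat_r; [apply pow_le; lra | exact HK].
      - rewrite Rmult_assoc, <- Rpow_mult_distr; do 2 f_equal; lra. }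
    replace (sum_n (fun k => a k * z ^ k)%C N : C)
      with (f z + (sum_n (fun k => a k * z ^ k)%C N - f z))%C by Cring.
    eapply Rle_trans; [apply Cmod_triangle|].
    specialize (HM z Hz); lra. }
  assert (L : is_lim_seq (fun N => M + K * (1 / 2) ^ N) (M + K * 0)).
  { apply is_lim_seq_plus'; [apply is_lim_seq_const|].
    apply (is_lim_seq_scal_l _ K 0), is_lim_seq_geom; rewrite Rabs_pos_eq; lra. }
  rewrite Rmult_0_r, Rplus_0_r in L.
  apply (is_lim_seq_le_loc (fun _ => Cmod (a n) * r ^ n) _ (Cmod (a n) * r ^ n) M) in L;
    [exact L | | apply is_lim_seq_const].
  exists n; exact Hbd.
Qed.

(** * Entire functions from rapidly decreasing coefficients *)

(** Equivalently, the power series with coefficients [u] has infinite radius of convergence. *)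
Definition rapidly_decreasing (u : nat -> C) :=
  forall r : R, 0 < r -> exists M : R, forall n, Cmod (u n) * r ^ n <= M.

(** Boundedness at radius s/q is geometric decay of ratio q at radius s. *)
Lemma rapidly_decreasing_geom (u : nat -> C) (s q : R) :
  rapidly_decreasing u -> 0 < s -> 0 < q ->
  exists M, 0 <= M /\ forall n, Cmod (u n) * s ^ n <= M * q ^ n.
Proof.
  intros Hu Hs Hq.
  destruct (Hu (s / q)) as [M HM]; [now apply Rdiv_lt_0_compat|].
  exists M; split.
  - specialize (HM O); simpl in HM; generalize (Cmod_ge_0 (u O)); lra.
  - intros n.
    replace (Cmod (u n) * s ^ n) with (Cmod (u n) * (s / q) ^ n * q ^ n).
    + apply Rmult_le_compat_r; [apply pow_le; lra | apply HM].
    + rewrite Rmult_assoc, <- Rpow_mult_distr; do 2 f_equal; field; lra.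
Qed.

(** The remainders satisfy R_(n+1) = (z + h) R_n + n z^(n-1) h^2. With n <= 4^n and rho >= 1, the
    new bound rho (4 rho)^n + (4 rho)^n is at most (4 rho)^(n+1). *)
Lemma pow_second_order_bound (z h : C) (rho : R) (n : nat) :
  1 <= rho -> Cmod z <= rho -> Cmod (z + h) <= rho ->
  Cmod ((z + h) ^ n - z ^ n - INR n * z ^ pred n * h) <= Cmod h ^ 2 * (4 * rho) ^ n.
Proof.
  intros Hrho Hz Hw; induction n as [|n IH].
  - simpl; replace (1 - 1 - 0 * 1 * h)%C with (RtoC 0) by ring.
    rewrite Cmod_0; generalize (pow2_ge_0 (Cmod h)); simpl; lra.
  (* At n = 0, where [pred 0] is 0, the factor [INR 0] makes both sides vanish. *)
  - assert (Hpred : (INR n * z ^ n = INR n * z ^ pred n * z)%C).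
    { destruct n; simpl pred; [simpl; ring | rewrite Cpow_S; ring]. }
    replace ((z + h) ^ S n - z ^ S n - INR (S n) * z ^ pred (S n) * h)%C
      with ((z + h) * ((z + h) ^ n - z ^ n - INR n * z ^ pred n * h)
            + INR n * z ^ pred n * (h * h))%C.
    2: { rewrite !Cpow_S, S_INR, RtoC_plus; simpl pred.
         transitivity ((z + h) * (z + h) ^ n - z * z ^ n - z ^ n * h
           - (INR n * z ^ pred n * z) * h)%C; [ring | rewrite <- Hpred; ring]. }
    eapply Rle_trans; [apply Cmod_triangle|].
    rewrite !Cmod_mult, Cmod_R, Cmod_pow, Rabs_pos_eq by apply pos_INR.
    assert (Hh := Cmod_ge_0 h); assert (Hz0 := Cmod_ge_0 z).
    assert (H1 : Cmod z ^ pred n <= rho ^ n).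
    { apply Rle_trans with (rho ^ pred n); [apply pow_incr; lra|].
      apply Rle_pow; [lra | lia]. }
    assert (H2 : INR n <= 4 ^ n).
    { apply Rle_trans with (2 ^ n); [left; apply INR_lt_pow2 | apply pow_incr; lra]. }
    assert (H3 : INR n * Cmod z ^ pred n <= (4 * rho) ^ n).
    { rewrite Rpow_mult_distr; apply Rmult_le_compat;
        [apply pos_INR | apply pow_le; lra | assumption..]. }
    assert (H4 : 0 <= (4 * rho) ^ n) by (apply pow_le; lra).
    assert (H5 : Cmod (z + h) * Cmod ((z + h) ^ n - z ^ n - INR n * z ^ pred n * h)
      <= rho * (Cmod h ^ 2 * (4 * rho) ^ n))
      by (apply Rmult_le_compat; [apply Cmod_ge_0 | apply Cmod_ge_0 | assumption..]).
    assert (H6 : INR n * Cmod z ^ pred n * (Cmod h * Cmod h) <= (4 * rho) ^ n * (Cmod h * Cmod h))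
      by (apply Rmult_le_compat_r; [nra | exact H3]).
    simpl pow in *.
    assert (0 <= (Cmod h * Cmod h) * (4 * rho) ^ n) by (apply Rmult_le_pos; nra).
    nra.
Qed.

(** The derivative is the termwise one: summing the second-order remainders of the monomials leaves
    an error of at most 2 M |h|^2. *)
Lemma pseries_entire (b : nat -> C) (g : C -> C) :
  rapidly_decreasing b -> (forall z, is_pseries b z (g z)) -> entire g.
Proof.
  intros Hb Hg z.
  set (rho := Cmod z + 1).
  assert (Hz0 := Cmod_ge_0 z).
  destruct (rapidly_decreasing_geom b (4 * rho) (1 / 2) Hb) as [M [HM0 HM]];
    [unfold rho; lra | lra |].
  assert (Hl : ex_series (fun n => b n * (INR n * z ^ pred n))%C).
  { apply (ex_series_Cgeom _ M (1 / 2)); [lra|]; intros n.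
    eapply Rle_trans; [|apply HM].
    rewrite !Cmod_mult, Cmod_R, Cmod_pow, Rabs_pos_eq by apply pos_INR.
    apply Rmult_le_compat_l; [apply Cmod_ge_0|].
    rewrite Rpow_mult_distr; apply Rmult_le_compat;
      [apply pos_INR | apply pow_le; lra | |].
    - apply Rle_trans with (2 ^ n); [left; apply INR_lt_pow2 | apply pow_incr; lra].
    - apply Rle_trans with (rho ^ pred n); [apply pow_incr; unfold rho; lra|].
      apply Rle_pow; [unfold rho; lra | lia]. }
  destruct Hl as [l Hl]; exists l.
  split; [apply is_linear_scal_l|].
  intros x Hx.
  apply (is_filter_lim_locally_unique (V := AbsRing_NormedModule C_AbsRing)) in Hx; subst x.
  intros eps.
  (* The bound 1 keeps z + h in the disc of radius [rho]; the other one gives 2 M |h| <= eps, with +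
     1 keeping the denominator positive. *)
  assert (Hd : 0 < Rmin 1 (eps / (2 * M + 1))).
  { apply Rmin_glb_lt; [lra|]; apply Rdiv_lt_0_compat; [apply cond_pos | lra]. }
  apply (locally_le_locally_norm (V := AbsRing_NormedModule C_AbsRing)).
  exists (mkposreal _ Hd); intros w Hw.
  change (Cmod (w - z) < Rmin 1 (eps / (2 * M + 1))) in Hw.
  change (Cmod ((g w - g z) - (w - z) * l) <= eps * Cmod (w - z)).
  set (h := (w - z)%C) in *.
  assert (Ew : w = (z + h)%C) by (unfold h; Cring).
  assert (Hh1 : Cmod h < 1) by (eapply Rlt_le_trans; [exact Hw | apply Rmin_l]).
  assert (Hh2 : Cmod h < eps / (2 * M + 1)) by (eapply Rlt_le_trans; [exact Hw | apply Rmin_r]).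
  assert (Hser : is_series (fun n => b n * ((z + h) ^ n - z ^ n - INR n * z ^ pred n * h))%C
    ((g w - g z) - h * l)%C).
  { apply is_series_ext with (fun n => (b n * w ^ n + (-(1)) * (b n * z ^ n))
      + (- h) * (b n * (INR n * z ^ pred n)))%C.
    - intros n; rewrite Ew; Cring.
    - replace ((g w - g z) - h * l)%C with ((g w + (-(1)) * g z) + (- h) * l)%C by ring.
      apply is_series_Cplus; [apply is_series_Cplus; [|apply is_series_Cmult_l] |
        apply is_series_Cmult_l; exact Hl]; apply is_pseries_C, Hg. }
  apply (Cmod_series_le_geom _ _ (M * Cmod h ^ 2) (1 / 2)) in Hser; [|lra|].
  - assert (Hh0 := Cmod_ge_0 h).
    apply (Rmult_lt_compat_r (2 * M + 1)) in Hh2; [|lra].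
    unfold Rdiv in Hh2; rewrite Rmult_assoc, Rinv_l, Rmult_1_r in Hh2 by lra.
    nra.
  - intros n; rewrite Cmod_mult.
    apply Rle_trans with (Cmod (b n) * (Cmod h ^ 2 * (4 * rho) ^ n)).
    + apply Rmult_le_compat_l; [apply Cmod_ge_0|].
      apply pow_second_order_bound; unfold rho; [lra | lra |].
      eapply Rle_trans; [apply Cmod_triangle | lra].
    + specialize (HM n); generalize (pow2_ge_0 (Cmod h)); intros.
      replace (Cmod (b n) * (Cmod h ^ 2 * (4 * rho) ^ n))
        with (Cmod h ^ 2 * (Cmod (b n) * (4 * rho) ^ n)) by ring.
      replace (M * Cmod h ^ 2 * (1 / 2) ^ n) with (Cmod h ^ 2 * (M * (1 / 2) ^ n)) by ring.
      now apply Rmult_le_compat_l.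
Qed.

(** * q-numbers and the coefficients of the q-exponential *)

Lemma qnum_0 (p : R) : p <> 1 -> qnum p 0 = 0.
Proof. intros Hp; unfold qnum; simpl; field; lra. Qed.

Lemma qnum_S (p : R) (n : nat) : p <> 1 -> qnum p (S n) = qnum p n + p ^ n.
Proof. intros Hp; unfold qnum; simpl; field; lra. Qed.

Lemma qnum_S_ge (p : R) (n : nat) : 1 < p -> 1 <= p ^ n <= qnum p (S n).
Proof.
  intros Hp.
  assert (H : forall k, 0 <= qnum p k).
  { induction k as [|k IH]; [rewrite qnum_0; lra|].
    rewrite qnum_S by lra; assert (0 < p ^ k) by (apply pow_lt; lra); lra. }
  rewrite qnum_S by lra; split; [apply pow_R1_Rle; lra|].
  specialize (H n); lra.
Qed.

Lemma qfact_ge_1 (p : R) (n : nat) : 1 < p -> 1 <= qfact p n.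
Proof.
  intros Hp; induction n as [|n IH]; simpl; [lra|].
  generalize (qnum_S_ge p n Hp); nra.
Qed.

(** Each factor satisfies [j]_p <= p^j / (p - 1); the exponential form is ready to be combined with
    Cauchy's estimate. *)
Lemma qfact_le_exp (p : R) (n : nat) : 1 < p ->
  qfact p n <= exp (ln p * (INR n * (INR n + 1) / 2) - INR n * ln (p - 1)).
Proof.
  intros Hp; induction n as [|n IH].
  - simpl; replace (ln p * (0 * (0 + 1) / 2) - 0 * ln (p - 1)) with 0 by lra.
    rewrite exp_0; lra.
  - simpl qfact; rewrite S_INR.
    replace (ln p * ((INR n + 1) * (INR n + 1 + 1) / 2) - (INR n + 1) * ln (p - 1))
      with (ln p * (INR n * (INR n + 1) / 2) - INR n * ln (p - 1)
            + (INR (S n) * ln p + - ln (p - 1))) by (rewrite S_INR; field).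
    rewrite exp_plus.
    apply Rmult_le_compat; [generalize (qfact_ge_1 p n Hp); lra | | exact IH |].
    + generalize (qnum_S_ge p n Hp); lra.
    + rewrite exp_plus, exp_Ropp, exp_ln, <- ln_pow, exp_ln by (try apply pow_lt; lra).
      unfold qnum.
      replace ((1 - p ^ S n) / (1 - p)) with ((p ^ S n - 1) * / (p - 1)) by (field; lra).
      apply Rmult_le_compat_r; [|lra].
      left; apply Rinv_0_lt_compat; lra.
Qed.

(** By the q-binomial theorem these are the coefficients of the product of the two q-exponentials,
    sum_k t^k / [k]_p! and sum_k p^(k(k-1)/2) t^k / [k]_p!, taken at t/2. *)
Definition qexp_coeff (p : R) (k : nat) : R := qpoch (-1) p k / 2 ^ k / qfact p k.

Lemma qexp_coeff_0 p : qexp_coeff p 0 = 1.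
Proof. unfold qexp_coeff; simpl; field. Qed.

(** This gives (E(t) - 1) / t the constant term 1, which the recursion for its reciprocal
    requires. *)
Lemma qexp_coeff_1 p : p <> 1 -> qexp_coeff p 1 = 1.
Proof.
  intros Hp; unfold qexp_coeff; simpl; rewrite qnum_S, qnum_0 by exact Hp; simpl; field.
Qed.

(* The ratio of consecutive coefficients is [(1 + p^k) / (2 [k+1]_p)], and
   [k+1]_p dominates both [1] and [p^k]. *)
Lemma qexp_coeff_bounds p k : 1 < p -> 0 <= qexp_coeff p k <= 1.
Proof.
  intros Hp; induction k as [|k IH]; [rewrite qexp_coeff_0; lra|].
  assert (Hq := qnum_S_ge p k Hp); assert (Hf := qfact_ge_1 p k Hp).
  assert (0 < 2 ^ k) by (apply pow_lt; lra).
  replace (qexp_coeff p (S k))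
    with (qexp_coeff p k * ((1 + p ^ k) / (2 * qnum p (S k)))).
  - assert (H1 : 0 <= (1 + p ^ k) / (2 * qnum p (S k)) <= 1).
    { split.
      - apply Rmult_le_pos; [lra|]; left; apply Rinv_0_lt_compat; lra.
      - apply Rmult_le_reg_r with (2 * qnum p (S k)); [lra|].
        unfold Rdiv; rewrite Rmult_assoc, Rinv_l by lra; lra. }
    nra.
  - unfold qexp_coeff; simpl qpoch; simpl qfact; simpl pow; field; lra.
Qed.

(** * The functional equation on coefficients *)

(** Each coefficient depends on all earlier ones, so stage n is a table whose entries are meaningful
    up to index n only. *)
Fixpoint inverse_approx (d : nat -> C) (n : nat) : nat -> C :=
  match n with
  | O => fun _ => RtoC 1
  | S n' => fun m =>
      if Nat.leb m n' then inverse_approx d n' m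
      else (- sum_n (fun k => d (S k) * inverse_approx d n' (n' - k)) n')%C
  end.

(* The coefficients of the reciprocal of the formal series [sum_k d k t^k],
   where [d 0 = 1]. *)
Definition inverse_coeff (d : nat -> C) (n : nat) : C := inverse_approx d n n.

Lemma inverse_coeff_S (d : nat -> C) n :
  inverse_coeff d (S n) = (- sum_n (fun k => d (S k) * inverse_coeff d (n - k)) n)%C.
Proof.
  (* Later stages do not alter the entries already computed. *)
  assert (Hst : forall n m, (m <= n)%nat -> inverse_approx d n m = inverse_coeff d m).
  { clear n; induction n as [|n IH]; intros m Hm.
    - replace m with O by lia; reflexivity.
    - destruct (Nat.eq_dec m (S n)) as [->|Hne]; [reflexivity|].
      simpl; rewrite (proj2 (Nat.leb_le m n)) by lia; apply IH; lia. }
  unfold inverse_coeff at 1; cbn [inverse_approx].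
  rewrite (proj2 (Nat.leb_gt (S n) n)) by lia; f_equal.
  apply sum_n_ext; intros k; f_equal; apply Hst; lia.
Qed.

Lemma inverse_coeff_spec (d : nat -> C) n : d O = RtoC 1 ->
  sum_n (fun k => d k * inverse_coeff d (n - k))%C n = if n then RtoC 1 else RtoC 0.
Proof.
  intros H0; destruct n as [|n].
  - rewrite sum_O, H0; unfold inverse_coeff; simpl; Cring.
  - rewrite Csum_split_first, H0, Nat.sub_0_r, inverse_coeff_S.
    simpl Nat.sub; Cring.
Qed.

(** The recursion gives |e_(n+1)| <= |e_0| + ... + |e_n| <= 1 + 2 + ... + 2^n < 2^(n+1). *)
Lemma inverse_coeff_bound (d : nat -> C) n :
  (forall k, Cmod (d k) <= 1) -> Cmod (inverse_coeff d n) <= 2 ^ n.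
Proof.
  intros Hd; induction n as [n IH] using lt_wf_ind; destruct n as [|n].
  - unfold inverse_coeff; simpl; rewrite Cmod_1; lra.
  - rewrite inverse_coeff_S, Cmod_opp.
    rewrite (Csum_rev (fun k => d (S k) * inverse_coeff d (n - k))%C).
    eapply Rle_trans; [apply (Cmod_Csum _ (fun k => 2 ^ k))|].
    + intros k Hk.
      replace (n - (n - k))%nat with k by lia.
      rewrite Cmod_mult.
      specialize (IH k ltac:(lia)); specialize (Hd (S (n - k))).
      generalize (Cmod_ge_0 (inverse_coeff d k)); intros.
      eapply Rle_trans; [|exact IH]; nra.
    + clear; assert (H : sum_n (fun k => 2 ^ k) n <= 2 ^ S n - 1); [|lra].
      induction n as [|n IH]; [rewrite sum_O; simpl; lra|].
      rewrite sum_Sn; change plus with Rplus; simpl in *; lra.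
Qed.

Lemma exp_monotone (x y : R) : x <= y -> exp x <= exp y.
Proof. intros [H| ->]; [left; now apply exp_increasing | lra]. Qed.

Lemma growth_coeff_rapidly_decreasing (p c : R) (f : C -> C) (a : nat -> C) :
  1 < p -> c < 1 -> (forall z, is_pseries a z (f z)) ->
  p_exp_growth p (c * ln p) f ->
  rapidly_decreasing (fun n => a n * qfact p n)%C.
Proof.
  intros Hp Hc Ha [K [alpha [HK Hf]]] r Hr.
  set (L := ln p).
  assert (HL : 0 < L) by (unfold L; rewrite <- ln_1; apply ln_increasing; lra).
  (* In the exponent of the final bound, [beta] is the coefficient of n and [- eps] that of n^2; c <
     1 makes [eps] positive. The maximum of beta x - eps x^2 is beta^2 / (4 eps). *)
  set (beta := alpha * L + L / 2 - ln (p - 1) + ln r).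
  set (eps := L * (1 - c) / 2).
  assert (Heps : 0 < eps) by (unfold eps; nra).
  exists (K * exp (beta ^ 2 / (4 * eps))); intros n.
  set (x := INR n).
  assert (Hpn : 0 < p ^ n) by (apply pow_lt; lra).
  assert (Hln : ln (p ^ n) = x * L) by (apply ln_pow; lra).
  assert (HC : Cmod (a n) * (p ^ n) ^ n <= K * exp (alpha * (x * L) + c * L * x ^ 2 / 2)).
  { apply (cauchy_estimate a f); [lra | exact Ha |].
    intros z Hz.
    assert (Hz0 : z <> RtoC 0).
    { apply Cmod_gt_0; lra. }
    left; eapply Rlt_le_trans; [apply Hf, Hz0|].
    unfold Rpower; rewrite Hz, Hln, Rmult_assoc, <- exp_plus.
    apply Req_le; do 3 f_equal; fold L; field; lra. }
  assert (Epn : (p ^ n) ^ n = exp (x * (x * L))).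
  { rewrite <- Hln; unfold x; rewrite <- ln_pow, exp_ln by (try apply pow_lt; lra); reflexivity. }
  assert (Ern : r ^ n = exp (x * ln r)).
  { unfold x; rewrite <- ln_pow, exp_ln by (try apply pow_lt; lra); reflexivity. }
  assert (Ha' : Cmod (a n) <= K * exp (alpha * (x * L) + c * L * x ^ 2 / 2 - x * (x * L))).
  { rewrite Epn in HC.
    unfold Rminus at 1; rewrite exp_plus, <- Rmult_assoc, exp_Ropp.
    apply Rmult_le_reg_r with (exp (x * (x * L))); [apply exp_pos|].
    rewrite (Rmult_assoc _ (/ _)), Rinv_l, Rmult_1_r; [exact HC|].
    apply Rgt_not_eq, exp_pos. }
  rewrite Cmod_mult, Cmod_R, Rabs_pos_eq by (generalize (qfact_ge_1 p n Hp); lra).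
  rewrite Ern.
  apply Rle_trans with (K * exp (alpha * (x * L) + c * L * x ^ 2 / 2 - x * (x * L))
    * exp (L * (x * (x + 1) / 2) - x * ln (p - 1)) * exp (x * ln r)).
  - apply Rmult_le_compat_r; [left; apply exp_pos|].
    apply Rmult_le_compat; [apply Cmod_ge_0 | | exact Ha' | apply qfact_le_exp, Hp].
    generalize (qfact_ge_1 p n Hp); lra.
  - rewrite !Rmult_assoc, <- !exp_plus.
    apply Rmult_le_compat_l; [lra|].
    apply exp_monotone.
    replace (beta ^ 2 / (4 * eps))
      with (beta * x - eps * x ^ 2 + (2 * eps * x - beta) ^ 2 / (4 * eps))
      by (field; lra).
    assert (0 <= (2 * eps * x - beta) ^ 2 / (4 * eps)).
    { apply Rmult_le_pos; [apply pow2_ge_0 | left; apply Rinv_0_lt_compat; lra]. }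
    unfold beta, eps in *; nra.
Qed.

(** Here [d] lists the coefficients of (E(t) - 1) / t, hence the index [S (m + k)]. Regrouping the
    double sum of d_k e_j A_(m+k+j) by n = k + j leaves A_m, since [e] is the reciprocal series of
    [d]. *)
Lemma shift_equation_solvable (d A : nat -> C) :
  d O = RtoC 1 -> (forall k, Cmod (d k) <= 1) -> rapidly_decreasing A ->
  exists B : nat -> C, rapidly_decreasing B /\
    forall m, is_series (fun k => d k * B (S (m + k)))%C (A m).
Proof.
  intros H0 Hd HA.
  set (e := inverse_coeff d).
  assert (He : forall n, Cmod (e n) <= 2 ^ n) by (intros; now apply inverse_coeff_bound).
  (* As |e_j| <= 2^j, decay of ratio 1/4 in j needs 2 <= s/4. *)
  assert (Hdom : forall s, 8 <= s -> exists M, 0 <= M /\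
    forall m j, Cmod (e j * A (m + j)%nat) * s ^ m <= M * (1 / 4) ^ j).
  { intros s Hs.
    destruct (rapidly_decreasing_geom A s 1 HA) as [M [HM0 HM]]; [lra | lra |].
    exists M; split; [exact HM0|]; intros m j.
    specialize (HM (m + j)%nat); rewrite pow1, pow_add, Rmult_1_r in HM.
    rewrite Cmod_mult.
    assert (Hm : 0 < s ^ m) by (apply pow_lt; lra).
    assert (H8 : 2 ^ j <= s ^ j * (1 / 4) ^ j).
    { rewrite <- Rpow_mult_distr; apply pow_incr; lra. }
    assert (Hej := He j); assert (HAj := Cmod_ge_0 (A (m + j)%nat)).
    apply Rle_trans with ((s ^ j * (1 / 4) ^ j) * (Cmod (A (m + j)%nat) * s ^ m)).
    - rewrite Rmult_assoc; apply Rmult_le_compat_r; [apply Rmult_le_pos; lra | lra].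
    - assert (0 < (1 / 4) ^ j) by (apply pow_lt; lra).
      replace (s ^ j * (1 / 4) ^ j * (Cmod (A (m + j)%nat) * s ^ m))
        with (Cmod (A (m + j)%nat) * (s ^ m * s ^ j) * (1 / 4) ^ j) by ring.
      apply Rmult_le_compat_r; lra. }
  destruct (functional_choice (fun m l => is_series (fun j => e j * A (m + j)%nat)%C l))
    as [B' HB'].
  { intros m; destruct (Hdom 8) as [M [HM0 HM]]; [lra|].
    apply (ex_series_Cgeom _ M (1 / 4)); [lra|]; intros j.
    eapply Rle_trans; [|apply (HM m j)].
    assert (1 <= 8 ^ m) by (apply pow_R1_Rle; lra).
    generalize (Cmod_ge_0 (e j * A (m + j)%nat)); nra. }
  (* The equations start at B_1; the free value B_0, which becomes the constant term of g, is set to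
     0. *)
  exists (fun n => match n with O => RtoC 0 | S m => B' m end); split.
  - intros r Hr.
    set (s := Rmax 8 r).
    assert (Hs8 : 8 <= s) by apply Rmax_l.
    assert (Hsr : r <= s) by apply Rmax_r.
    destruct (Hdom s Hs8) as [M [HM0 HM]].
    assert (HB : forall m, Cmod (B' m) * s ^ m <= 2 * M).
    { intros m.
      assert (Hm : 0 < s ^ m) by (apply pow_lt; lra).
      apply Rmult_le_reg_r with (/ s ^ m); [now apply Rinv_0_lt_compat|].
      rewrite Rmult_assoc, Rinv_r, Rmult_1_r, Rmult_assoc by lra.
      apply (Cmod_series_le_geom _ _ _ (1 / 4)) with (3 := HB' m); [lra|].
      intros j; apply Rmult_le_reg_r with (s ^ m); [exact Hm|].
      replace (M * / s ^ m * (1 / 4) ^ j * s ^ m) with (M * (1 / 4) ^ j)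
        by (field; lra).
      apply HM. }
    (* The extra factor [s] pays for the shift from [B'] to [B]. *)
    exists (2 * M * s); intros [|n]; [rewrite Cmod_0, Rmult_0_l; nra|].
    apply Rle_trans with (Cmod (B' n) * s ^ S n).
    + apply Rmult_le_compat_l; [apply Cmod_ge_0 | apply pow_incr; lra].
    + simpl; specialize (HB n); nra.
  - intros m.
    destruct (rapidly_decreasing_geom A 8 1 HA) as [M [HM0 HM]]; [lra | lra |].
    set (u := fun k j => (d k * (e j * A (m + k + j)%nat))%C).
    apply (series_rows_diagonals u _ M).
    + intros k j; unfold u; rewrite !Cmod_mult.
      specialize (HM (m + k + j)%nat); rewrite pow1, Rmult_1_r in HM.
      assert (Hj : Cmod (e j) <= 2 ^ (m + k + j)).
      { apply Rle_trans with (2 ^ j); [apply He | apply Rle_pow; [lra | lia]]. }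
      assert (H4 : (1 / 4) ^ (m + k + j) <= (1 / 4) ^ (k + j)).
      { rewrite <- Nat.add_assoc, (pow_add _ m).
        assert ((1 / 4) ^ m <= 1).
        { apply Rle_trans with (1 ^ m); [apply pow_incr; lra | rewrite pow1; lra]. }
        assert (0 <= (1 / 4) ^ (k + j)) by (apply pow_le; lra); nra. }
      set (n := (m + k + j)%nat) in *.
      assert (Hp : 2 ^ n = 8 ^ n * (1 / 4) ^ n)
        by (rewrite <- Rpow_mult_distr; f_equal; lra).
      assert (Hq : 0 <= (1 / 4) ^ n) by (apply pow_le; lra).
      assert (HAn := Cmod_ge_0 (A n)); assert (Hen := Cmod_ge_0 (e j)).
      apply Rle_trans with (2 ^ n * Cmod (A n)).
      * rewrite <- (Rmult_1_l (2 ^ n * _)).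
        apply Rmult_le_compat;
          [apply Cmod_ge_0 | now apply Rmult_le_pos | apply Hd | now apply Rmult_le_compat_r].
      * rewrite Hp; replace (8 ^ n * (1 / 4) ^ n * Cmod (A n))
          with (Cmod (A n) * 8 ^ n * (1 / 4) ^ n) by ring.
        apply Rmult_le_compat; [| exact Hq | exact HM | exact H4].
        apply Rmult_le_pos; [lra | apply pow_le; lra].
    + intros k; apply is_series_Cmult_l, HB'.
    + apply is_series_ext with (fun n => match n with O => A m | _ => RtoC 0 end).
      * intros n.
        (* Along the diagonal k + j = n the factor A_(m+n) is constant, and the convolution of d and
           e is 1 for n = 0 and 0 otherwise. *)
        transitivity (A (m + n)%nat * sum_n (fun k => d k * e (n - k)%nat) n)%C.
        -- unfold e; rewrite inverse_coeff_spec by exact H0.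
           destruct n; [rewrite Nat.add_0_r|]; Cring.
        -- rewrite <- Csum_mult_l; apply sum_n_ext_loc; intros k Hk; unfold u.
           replace (m + k + (n - k))%nat with (m + n)%nat by lia; Cring.
      * apply is_series_Cmod.
        apply is_lim_seq_ext with (fun _ => 0); [|apply is_lim_seq_const].
        intros n; symmetry; transitivity (Cmod 0); [f_equal | apply Cmod_0].
        induction n as [|n IH]; [rewrite sum_O; simpl; Cring|].
        rewrite Csum_S; etransitivity; [|exact IH]; simpl; Cring.
Qed.

(* Coefficient of [x^i] in [b_n T_n(x)], after cancelling [[n]_p!]. *)
Lemma Tmono_expansion (p : R) (B : nat -> C) (n : nat) (x : C) : 1 < p ->
  (B n / qfact p n * Tmono p (fun k => RtoC (qpoch (-1) p k / 2 ^ k)) n x)%C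
  = sum_n (fun i => x ^ i / qfact p i * (qexp_coeff p (n - i) * B (i + (n - i))%nat))%C n.
Proof.
  intros Hp; unfold Tmono; rewrite <- Csum_mult_l.
  rewrite (Csum_rev (fun i => x ^ i / qfact p i * _)%C).
  apply sum_n_ext_loc; intros k Hk.
  replace (n - (n - k))%nat with k by lia.
  replace (n - k + k)%nat with n by lia.
  assert (Hq : forall i, RtoC (qfact p i) <> RtoC 0).
  { intros i E; apply RtoC_inj in E; generalize (qfact_ge_1 p i Hp); lra. }
  assert (Hq' : forall i, qfact p i <> 0).
  { intros i E; generalize (qfact_ge_1 p i Hp); lra. }
  unfold qexp_coeff, qbinom.
  set (delta := qpoch (-1) p k / 2 ^ k).
  rewrite !RtoC_div, RtoC_mult by
    (try apply Rmult_integral_contrapositive_currified; apply Hq').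
  change ((B n / qfact p n * (qfact p n / (qfact p k * qfact p (n - k)) * x ^ (n - k) * delta)
    = x ^ (n - k) / qfact p (n - k) * (delta / qfact p k * B n)))%C.
  field; repeat split; apply Hq.
Qed.

(** * Construction of the entire solution *)

Theorem theorem3 (p c : R) (f : C -> C) (a : nat -> C)
  (hp : 1 < p) (hc : c < 1)
  (hf : entire f)
  (hfa : forall z : C, is_pseries a z (f z))
  (hgrowth : p_exp_growth p (c * ln p) f) :
  exists (g : C -> C) (b : nat -> C),
    entire g /\
    (forall z : C, is_pseries b z (g z)) /\
    exists Tg : C -> C,
      (forall z : C,
         is_Tshift p (fun k : nat => RtoC (qpoch (-1) p k / 2 ^ k)) b z (Tg z)) /\
      (forall z : C, (Tg z - g z)%C = f z).
Proof.
  assert (Hq : forall i, RtoC (qfact p i) <> RtoC 0).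
  { intros i E; apply RtoC_inj in E; generalize (qfact_ge_1 p i hp); lra. }
  set (d := qexp_coeff p).
  assert (Hd : forall k, Cmod (d k) <= 1).
  { intros k; generalize (qexp_coeff_bounds p k hp); intros H.
    rewrite Cmod_R, Rabs_pos_eq; unfold d; lra. }
  (* The coefficients are shifted by one: index 0 holds d_1 = 1. *)
  destruct (shift_equation_solvable (fun k => RtoC (d (S k))) (fun n => a n * qfact p n)%C)
    as [B [HB HBA]].
  { unfold d; rewrite qexp_coeff_1; [reflexivity | lra]. }
  { intros k; apply Hd. }
  { now apply (growth_coeff_rapidly_decreasing p c f). }
  set (b := fun n => (B n / qfact p n)%C).
  assert (Hqinv : forall i, Cmod (/ qfact p i) <= 1).
  { intros i; rewrite Cmod_inv, Cmod_R, Rabs_pos_eq by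
      (try apply Hq; generalize (qfact_ge_1 p i hp); lra).
    rewrite <- Rinv_1; apply Rinv_le_contravar; [lra | now apply qfact_ge_1]. }
  assert (Hb : rapidly_decreasing b).
  { intros r Hr; destruct (HB r Hr) as [M HM]; exists M; intros n.
    eapply Rle_trans; [|apply (HM n)].
    apply Rmult_le_compat_r; [apply pow_le; lra|].
    unfold b, Cdiv; rewrite Cmod_mult.
    generalize (Cmod_ge_0 (B n)), (Hqinv n); nra. }
  destruct (functional_choice (fun z l => is_pseries b z l)) as [g Hg].
  { intros z.
    destruct (rapidly_decreasing_geom b (Cmod z + 1) (1 / 2) Hb) as [M [HM0 HM]];
      [generalize (Cmod_ge_0 z); lra | lra |].
    destruct (ex_series_Cgeom (fun n => b n * z ^ n)%C M (1 / 2)) as [l Hl]; [lra | |].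
    - intros n; eapply Rle_trans; [|apply HM].
      rewrite Cmod_mult, Cmod_pow; apply Rmult_le_compat_l; [apply Cmod_ge_0|].
      apply pow_incr; generalize (Cmod_ge_0 z); lra.
    - exists l; now apply is_pseries_C. }
  exists g, b; split; [now apply (pseries_entire b)|]; split; [exact Hg|].
  (* With this choice the difference equation is immediate; what remains is that the series of T_n
     converges to f + g. *)
  exists (fun z => (f z + g z)%C); split; [|intros z; ring].
  intros z; unfold is_Tshift.
  set (rho := Cmod z + 1).
  assert (Hz0 := Cmod_ge_0 z).
  destruct (rapidly_decreasing_geom B rho (1 / 4) HB) as [M [HM0 HM]];
    [unfold rho; lra | lra |].
  (* Row i collects the terms in z^i, the entry k coming from T_(i+k); the diagonals are the terms
     b_n T_n(z). *)
  set (u := fun i k => (z ^ i / qfact p i * (d k * B (i + k)%nat))%C).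
  apply is_series_ext with (fun n => sum_n (fun i => u i (n - i)%nat) n).
  { intros n; symmetry; now apply Tmono_expansion. }
  apply (series_rows_diagonals u
    (fun i => z ^ i / qfact p i * (a i * qfact p i + B i))%C M).
  - intros i k; unfold u, Cdiv; rewrite !Cmod_mult, Cmod_pow.
    eapply Rle_trans; [|apply (HM (i + k)%nat)].
    assert (Hzi : Cmod z ^ i <= rho ^ (i + k)).
    { apply Rle_trans with (rho ^ i); [apply pow_incr; unfold rho; lra|].
      apply Rle_pow; [unfold rho; lra | lia]. }
    assert (Hz1 : 0 <= Cmod z ^ i) by now apply pow_le.
    specialize (Hqinv i); specialize (Hd k).
    rewrite Rmult_comm.
    apply Rmult_le_compat;
      [apply Rmult_le_pos; apply Cmod_ge_0 | apply Rmult_le_pos; [lra | apply Cmod_ge_0] | |].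
    + generalize (Cmod_ge_0 (B (i + k)%nat)); nra.
    + generalize (Cmod_ge_0 (/ qfact p i)); nra.
  - intros i; apply is_series_Cmult_l.
    (* The k = 0 term is d_0 B_i = B_i, and the equation solved by B sums the others to [i]_p!
       a_i. *)
    apply is_series_decr_1.
    replace (plus _ _) with (a i * qfact p i)%C.
    + apply is_series_ext with (2 := HBA i).
      intros k; now rewrite Nat.add_succ_r.
    + unfold d; rewrite qexp_coeff_0, Nat.add_0_r.
      change (a i * qfact p i = a i * qfact p i + B i + - (1 * B i))%C; ring.
  - apply is_series_ext with (fun n => a n * z ^ n + b n * z ^ n)%C.
    + intros n; unfold b; change ((a n * z ^ n + B n / qfact p n * z ^ n
        = z ^ n / qfact p n * (a n * qfact p n + B n))%C); field; apply Hq.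
    + apply is_series_Cplus; apply is_pseries_C; [apply hfa | apply Hg].
Qed.
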